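(* Let $\mathbb{F}$ be a field of characteristic zero and let $W(2)$ be the 8-dimensional $\mathbb{F}$-algebra with basis $e_1,\dots,e_8$ defined in the context. If $I$ is a non-trivial left ideal of $W(2)$, then $I$ is one of the following subspaces (where $\langle\cdot\rangle$ denotes $\mathbb{F}$-linear span): 1) $\langle e_1,e_2,e_3,e_4,\ \alpha e_5+\beta e_8,\ -\alpha e_6+\beta e_7\rangle$, where $\alpha,\beta\in\mathbb{F}$, $(\alpha,\beta)\neq(0,0)$; 2) $\langle e_1,e_2,e_3,e_4\rangle$; 3) $\langle e_5,e_6,e_7,e_8\rangle$; 4) $\langle \alpha e_5+\beta e_8,\ -\alpha e_6+\beta e_7\rangle$, where $\alpha,\beta\in\mathbb{F}$, $(\alpha,\beta)\neq(0,0)$.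
   Context: Let $V_2$ be a 2-dimensional vector space over $\mathbb{F}$ with basis $v_1,v_2$. $W(2)$ is the vector space of all bilinear maps $V_2\times V_2\to V_2$ with the (not necessarily associative, not necessarily unital) product $$(A\cdot B)(x,y)=A(v_1,B(x,y))-B(A(v_1,x),y)-B(x,A(v_1,y)),\qquad x,y\in V_2.$$ For $i,j,k\in\{1,2\}$ let $\alpha_{ij}^k\in W(2)$ be given by $\alpha_{ij}^k(v_t,v_l)=\delta_{it}\delta_{jl}v_k$. The basis $e_1,\dots,e_8$ of $W(2)$ is $e_1=\alpha_{11}^1-\alpha_{12}^2-\alpha_{21}^2$, $e_2=\alpha_{11}^2$, $e_3=\alpha_{22}^2-\alpha_{12}^1-\alpha_{21}^1$, $e_4=\alpha_{22}^1$, $e_5=2\alpha_{11}^1+\alpha_{12}^2+\alpha_{21}^2$, $e_6=2\alpha_{22}^2+\alpha_{12}^1+\alpha_{21}^1$, $e_7=\alpha_{12}^1-\alpha_{21}^1$, $e_8=\alpha_{12}^2-\alpha_{21}^2$. A left ideal of an algebra $W$ is a subspace $I$ with $WI\subseteq I$; it is non-trivial if $I\neq 0$ and $I\neq W$. *)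

(* Defs.v *)
From HB Require Import structures.
From mathcomp Require Import all_boot all_order all_algebra.

Set Implicit Arguments.
Unset Strict Implicit.
Unset Printing Implicit Defensive.

Import GRing.Theory.
Local Open Scope ring_scope.

(* The space of bilinear maps V x V -> V, in curried form: A x y stands for
   A(x, y). *)
Notation bilmap V := 'Hom(V, 'Hom(V, V)).

Section BilinearMaps.

Variables (F : fieldType) (V : vectType F).

(* linfun is only meaningful on linear functions, so bilfun f agrees with f only
   when f is bilinear (bilfunE); mulW and alpha below satisfy this (mulWE,
   alphaE). *)
Definition bilfun (f : V -> V -> V) : bilmap V :=
  linfun (fun x => linfun (f x)).

Lemma bilfunE (f : V -> V -> V) :
    (forall x, linear (f x)) -> (forall y, linear (f^~ y)) ->
  forall x y, bilfun f x y = f x y.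
Proof.
move=> linr linl.
have fE x y : linfun (f x) y = f x y.
  pose L := GRing.isLinear.Build _ _ _ _ (f x) (linr x).
  pose fL : {linear V -> V} := HB.pack (f x) L.
  exact: (lfunE fL).
have lin : linear (fun x => linfun (f x)).
  by move=> a x y; apply/lfunP => z; rewrite !lfunE /= lfunE /= !fE linl.
pose L := GRing.isLinear.Build _ _ _ _ (fun x => linfun (f x)) lin.
pose fL : {linear V -> 'Hom(V, V)} := HB.pack (fun x => linfun (f x)) L.
by move=> x y; rewrite /bilfun (lfunE fL) /= fE.
Qed.

(* v is the basis (v_1, v_2), so v_1 = v`_0 and v_2 = v`_1. *)
Variable v : 2.-tuple V.

Definition mulW (A B : bilmap V) : bilmap V :=
  bilfun (fun x y => A v`_0 (B x y) - B (A v`_0 x) y - B x (A v`_0 y)).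

Lemma mulWE (A B : bilmap V) (x y : V) :
  mulW A B x y = A v`_0 (B x y) - B (A v`_0 x) y - B x (A v`_0 y).
Proof.
have dist a (p q r p' q' r' : V) : (a *: p + p') - (a *: q + q')
    - (a *: r + r') = a *: (p - q - r) + (p' - q' - r').
  by rewrite !scalerBr !opprD (addrACA (a *: p)) [LHS]addrACA.
rewrite /mulW bilfunE // => {x y} [x|y] a s t; rewrite -dist.
  by rewrite !linearP.
by rewrite !(linearP, add_lfunE, scale_lfunE).
Qed.

Definition alpha (i j k : 'I_2) : bilmap V :=
  bilfun (fun x y => (coord v i x * coord v j y) *: v`_k).

Lemma alphaE (i j k t l : 'I_2) : basis_of fullv v ->
  alpha i j k v`_t v`_l = ((i == t)%:R * (j == l)%:R) *: v`_k.
Proof.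
move=> /basis_free vfree; rewrite bilfunE ?coord_free ?(eq_sym t) ?(eq_sym l) //.
  by move=> x a y z; rewrite linearP /= mulrDr scalerDl mulrCA scalerA.
by move=> y a x z; rewrite linearP /= mulrDl scalerDl -mulrA scalerA.
Qed.

(* aij_k is alpha_{ij}^k with the indices 1, 2 of the basis vectors. *)
Local Notation a11_1 := (alpha ord0 ord0 ord0).
Local Notation a11_2 := (alpha ord0 ord0 ord_max).
Local Notation a12_1 := (alpha ord0 ord_max ord0).
Local Notation a12_2 := (alpha ord0 ord_max ord_max).
Local Notation a21_1 := (alpha ord_max ord0 ord0).
Local Notation a21_2 := (alpha ord_max ord0 ord_max).
Local Notation a22_1 := (alpha ord_max ord_max ord0).
Local Notation a22_2 := (alpha ord_max ord_max ord_max).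

Definition e1 : bilmap V := a11_1 - a12_2 - a21_2.
Definition e2 : bilmap V := a11_2.
Definition e3 : bilmap V := a22_2 - a12_1 - a21_1.
Definition e4 : bilmap V := a22_1.
Definition e5 : bilmap V := 2 *: a11_1 + a12_2 + a21_2.
Definition e6 : bilmap V := 2 *: a22_2 + a12_1 + a21_1.
Definition e7 : bilmap V := a12_1 - a21_1.
Definition e8 : bilmap V := a12_2 - a21_2.

End BilinearMaps.

Section LeftIdeals.

Variables (F : fieldType) (W : vectType F) (mul : W -> W -> W).

Definition left_ideal (I : {vspace W}) : Prop :=
  forall a x : W, x \in I -> mul a x \in I.

Definition nontrivial_left_ideal (I : {vspace W}) : Prop :=
  [/\ left_ideal I, I <> 0%VS & I <> fullv].

End LeftIdeals.

(* Main.v *)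
From HB Require Import structures.
Require Import Defs.
From mathcomp Require Import all_boot all_order all_algebra.
From mathcomp Require Import ring.

Import GRing.Theory.
Local Open Scope ring_scope.

(* The left multiplication by A depends only on the endomorphism A(v_1, -) of
   V_2, which is arbitrary, so the left ideals are the submodules of the
   gl_2-module V_2^* (x) V_2^* (x) V_2.  Over sl_2 this module is the sum of the
   irreducible <e_1, e_2, e_3, e_4> = S^3 V_2 and of two copies of V_2, with
   bases (e_5, -e_6) and (e_8, e_7).  A submodule is therefore the sum of its
   components in S^3 V_2 (zero or everything) and in V_2 (x) F^2 (of the form
   V_2 (x) K with K a subspace of F^2). *)

(* Locked to keep unification from comparing sums of maps term by term. *)
HB.lock Definition comb (F : fieldType) (V : vectType F) (v : 2.-tuple V)
    (c1 c2 c3 c4 c5 c6 c7 c8 : F) : bilmap V :=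
  c1 *: e1 v + c2 *: e2 v + c3 *: e3 v + c4 *: e4 v
  + c5 *: e5 v + c6 *: e6 v + c7 *: e7 v + c8 *: e8 v.
Arguments comb {F V}.

Section LeftIdealsW2.

Set Implicit Arguments.
Unset Strict Implicit.
Unset Printing Implicit Defensive.

Variables (F : fieldType) (V : vectType F) (v : 2.-tuple V).
Hypotheses (charF0 : [pchar F] =i pred0) (v_basis : basis_of fullv v).

Local Notation e1 := (e1 v).
Local Notation e2 := (e2 v).
Local Notation e3 := (e3 v).
Local Notation e4 := (e4 v).
Local Notation e5 := (e5 v).
Local Notation e6 := (e6 v).
Local Notation e7 := (e7 v).
Local Notation e8 := (e8 v).
Local Notation comb := (comb v).

(** * Coordinates of bilinear maps *)

Definition coef (B : bilmap V) (i j k : 'I_2) : F := coord v k (B v`_i v`_j).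

Lemma ord2_ind (P : 'I_2 -> Prop) : P ord0 -> P ord_max -> forall i, P i.
Proof.
move=> P0 P1 i; have [->//|->//] : i = ord0 \/ i = ord_max.
by case: i => [[|[|?]] ?] //; [left | right]; apply: val_inj.
Qed.

Lemma coef_inj (A B : bilmap V) :
  (forall i j k, coef A i j k = coef B i j k) -> A = B.
Proof.
move=> eqAB; apply/lfunP => x; rewrite (coord_basis v_basis (memvf x)).
rewrite !linear_sum; apply: eq_bigr => i _; rewrite !linearZ; congr (_ *: _).
apply/lfunP => y; rewrite (coord_basis v_basis (memvf y)) !linear_sum.
apply: eq_bigr => j _; rewrite !linearZ; congr (_ *: _).
rewrite [LHS](coord_basis v_basis (memvf _)) [RHS](coord_basis v_basis (memvf _)).
by apply: eq_bigr => k _; congr (_ *: _); apply: eqAB.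
Qed.

Lemma coefD (A B : bilmap V) i j k :
  coef (A + B) i j k = coef A i j k + coef B i j k.
Proof. by rewrite /coef !add_lfunE linearD. Qed.

Lemma coefN (A : bilmap V) i j k : coef (- A) i j k = - coef A i j k.
Proof. by rewrite /coef !opp_lfunE linearN. Qed.

Lemma coefZ a (A : bilmap V) i j k : coef (a *: A) i j k = a * coef A i j k.
Proof. by rewrite /coef !scale_lfunE linearZ. Qed.

Lemma coef_alpha p q r i j k :
  coef (alpha v p q r) i j k = (p == i)%:R * (q == j)%:R * (r == k)%:R.
Proof.
by rewrite /coef alphaE // linearZ /= coord_free ?(basis_free v_basis) // eq_sym.
Qed.

(* Left multiplication by a map A with A(v_1, v_p) = v_q and A(v_1, -) zero on
   the other basis vector; ord0 and ord_max stand for the indices 1 and 2. *)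
Definition act (p q : 'I_2) : bilmap V -> bilmap V := mulW v (alpha v ord0 p q).

Lemma alpha0_apply p q x : alpha v ord0 p q v`_0 x = coord v p x *: v`_q.
Proof.
rewrite [in LHS](coord_basis v_basis (memvf x)) linear_sum (bigD1 p) //= big1.
  by rewrite addr0 linearZ /= (alphaE ord0 p q ord0 p) // !eqxx mulr1 scale1r.
move=> i /negbTE neq_ip; rewrite linearZ /= (alphaE ord0 p q ord0 i) //.
by rewrite (eq_sym p) neq_ip mulr0 scale0r scaler0.
Qed.

Lemma coef_act p q B i j k :
  coef (act p q B) i j k = (q == k)%:R * coef B i j p
    - (p == i)%:R * coef B q j k - (p == j)%:R * coef B i q k.
Proof.
have vfree := basis_free v_basis.
rewrite /coef /act mulWE !alpha0_apply !linearB !linearZ /= scale_lfunE !linearZ /=.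
by rewrite !coord_free // !(eq_sym p) (eq_sym q) mulrC.
Qed.

(** The list runs through the triples (i, j, k) in binary order, with [ord0] read as 0 and [ord_max]
    as 1. *)
Lemma coef_comb c1 c2 c3 c4 c5 c6 c7 c8 (i j k : 'I_2) :
  coef (comb c1 c2 c3 c4 c5 c6 c7 c8) i j k =
  [:: c1 + 2 * c5; c2; - c3 + c6 + c7; - c1 + c5 + c8;
      - c3 + c6 - c7; - c1 + c5 - c8; c4; c3 + 2 * c6]`_(4 * i + 2 * j + k).
Proof.
rewrite comb.unlock /Defs.e1 /Defs.e2 /Defs.e3 /Defs.e4 /Defs.e5 /Defs.e6.
rewrite /Defs.e7 /Defs.e8 !(coefD, coefN, coefZ, coef_alpha).
by elim/ord2_ind: i; elim/ord2_ind: j; elim/ord2_ind: k => /=; ring.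
Qed.

Ltac by_coef :=
  let i := fresh "i" in let j := fresh "j" in let k := fresh "k" in
  apply: coef_inj => i j k; rewrite ?coef_act ?(coefD, coefZ) !coef_comb;
  by elim/ord2_ind: i; elim/ord2_ind: j; elim/ord2_ind: k => /=; ring.

(** Splits an identity between two locked combinations into eight scalar equations for [ring]. *)
Lemma comb_congr a1 a2 a3 a4 a5 a6 a7 a8 b1 b2 b3 b4 b5 b6 b7 b8 :
  a1 = b1 -> a2 = b2 -> a3 = b3 -> a4 = b4 ->
  a5 = b5 -> a6 = b6 -> a7 = b7 -> a8 = b8 ->
  comb a1 a2 a3 a4 a5 a6 a7 a8 = comb b1 b2 b3 b4 b5 b6 b7 b8.
Proof. by do 8![move=> ->]. Qed.

Lemma combD a1 a2 a3 a4 a5 a6 a7 a8 b1 b2 b3 b4 b5 b6 b7 b8 :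
  comb a1 a2 a3 a4 a5 a6 a7 a8 + comb b1 b2 b3 b4 b5 b6 b7 b8 =
  comb (a1 + b1) (a2 + b2) (a3 + b3) (a4 + b4)
    (a5 + b5) (a6 + b6) (a7 + b7) (a8 + b8).
Proof. by_coef. Qed.

Lemma combZ a c1 c2 c3 c4 c5 c6 c7 c8 :
  a *: comb c1 c2 c3 c4 c5 c6 c7 c8 =
  comb (a * c1) (a * c2) (a * c3) (a * c4) (a * c5) (a * c6) (a * c7) (a * c8).
Proof. by_coef. Qed.

(** * Elementary left multiplications in the basis [e1], ..., [e8] *)

Lemma act00_comb c1 c2 c3 c4 c5 c6 c7 c8 :
  act ord0 ord0 (comb c1 c2 c3 c4 c5 c6 c7 c8) =
  comb (- c1) (- 2 * c2) 0 c4 (- c5) 0 0 (- c8).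
Proof. by_coef. Qed.

Lemma act10_comb c1 c2 c3 c4 c5 c6 c7 c8 :
  act ord_max ord0 (comb c1 c2 c3 c4 c5 c6 c7 c8) =
  comb c2 0 (2 * c1) (3 * c3) 0 (- c5) c8 0.
Proof. by_coef. Qed.

Lemma act01_comb c1 c2 c3 c4 c5 c6 c7 c8 :
  act ord0 ord_max (comb c1 c2 c3 c4 c5 c6 c7 c8) =
  comb (2 * c3) (3 * c1) c4 0 (- c6) 0 0 c7.
Proof. by_coef. Qed.

Lemma natr_neq0 n : n.+1%:R != 0 :> F.
Proof. by have /pcharf0P -> := charF0. Qed.

Lemma combP (x : bilmap V) :
  exists c1 c2 c3 c4 c5 c6 c7 c8, x = comb c1 c2 c3 c4 c5 c6 c7 c8.
Proof.
have n2 : 2 != 0 :> F := natr_neq0 1; have n3 : 3 != 0 :> F := natr_neq0 2.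
have n6 : 6 != 0 :> F := natr_neq0 5.
pose X := coef x.
(* The witnesses invert the linear system of [coef_comb]; the denominators 2, 3 and 6 are nonzero in
   characteristic zero. *)
exists ((X ord0 ord0 ord0 - X ord0 ord_max ord_max - X ord_max ord0 ord_max) / 3).
exists (X ord0 ord0 ord_max).
exists ((X ord_max ord_max ord_max - X ord0 ord_max ord0
  - X ord_max ord0 ord0) / 3).
exists (X ord_max ord_max ord0).
exists ((2 * X ord0 ord0 ord0 + X ord0 ord_max ord_max
  + X ord_max ord0 ord_max) / 6).
exists ((2 * X ord_max ord_max ord_max + X ord0 ord_max ord0
  + X ord_max ord0 ord0) / 6).
exists ((X ord0 ord_max ord0 - X ord_max ord0 ord0) / 2).
exists ((X ord0 ord_max ord_max - X ord_max ord0 ord_max) / 2).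
apply: coef_inj => i j k; rewrite coef_comb -/(X i j k).
by elim/ord2_ind: i; elim/ord2_ind: j; elim/ord2_ind: k => //=; field;
  rewrite ?n2 ?n3 ?n6.
Qed.

Lemma eE : (e1 = comb 1 0 0 0 0 0 0 0) * (e2 = comb 0 1 0 0 0 0 0 0) *
  (e3 = comb 0 0 1 0 0 0 0 0) * (e4 = comb 0 0 0 1 0 0 0 0) *
  (e5 = comb 0 0 0 0 1 0 0 0) * (e6 = comb 0 0 0 0 0 1 0 0) *
  (e7 = comb 0 0 0 0 0 0 1 0) * (e8 = comb 0 0 0 0 0 0 0 1).
Proof.
by do ?split; rewrite comb.unlock !scale0r scale1r ?add0r ?addr0.
Qed.

(** * Splitting an ideal into weight components *)

Variable I : {vspace bilmap V}.
Hypothesis idealI : left_ideal (mulW v) I.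

Lemma mem_comb_rescale t c1 c2 c3 c4 c5 c6 c7 c8 b1 b2 b3 b4 b5 b6 b7 b8 :
  t != 0 -> comb b1 b2 b3 b4 b5 b6 b7 b8 \in I ->
  b1 = t * c1 -> b2 = t * c2 -> b3 = t * c3 -> b4 = t * c4 ->
  b5 = t * c5 -> b6 = t * c6 -> b7 = t * c7 -> b8 = t * c8 ->
  comb c1 c2 c3 c4 c5 c6 c7 c8 \in I.
Proof.
move=> nz_t bI eq1 eq2 eq3 eq4 eq5 eq6 eq7 eq8; move: bI.
by rewrite eq1 eq2 eq3 eq4 eq5 eq6 eq7 eq8 -combZ rpredZeq (negPf nz_t).
Qed.

(** The last component is the [e6], [e7] part carried by [act ord0 ord_max] into the span of [e5]
    and [e8], so that both copies of V_2 are studied in that single plane. *)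
Lemma mem_comb_components c1 c2 c3 c4 c5 c6 c7 c8 :
  comb c1 c2 c3 c4 c5 c6 c7 c8 \in I ->
  [/\ comb c1 0 0 0 0 0 0 0 \in I, comb 0 c2 0 0 0 0 0 0 \in I,
      comb 0 0 c3 0 0 0 0 0 \in I & comb 0 0 0 c4 0 0 0 0 \in I] /\
  comb 0 0 0 0 c5 0 0 c8 \in I /\ comb 0 0 0 0 (- c6) 0 0 c7 \in I.
Proof.
have n2 : 2 != 0 :> F := natr_neq0 1; have n3 : 3 != 0 :> F := natr_neq0 2.
have n6 : 6 != 0 :> F := natr_neq0 5.
move=> D0.
have actI p q x : x \in I -> act p q x \in I by apply: idealI.
have D1 := actI ord0 ord0 _ D0; have D2 := actI ord0 ord0 _ D1.
have D3 := actI ord0 ord0 _ D2; rewrite !act00_comb in D1 D2 D3.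
(* act00 has eigenvalue -2 on e_2, -1 on e_1, e_5, e_8, 0 on e_3, e_6, e_7 and 1
   on e_4; the y's below are its spectral projections of the element. *)
have y2 : comb 0 c2 0 0 0 0 0 0 \in I.
  (* The polynomial s - s^3 vanishes at -1, 0, 1 and equals 6 at -2. Likewise s(s+1)(s+2),
     s(s-1)(s+2) and -(s-1)(s+1)(s+2) isolate the eigenvalues 1, -1 and 0, with values 6, 2 and
     2. *)
  move: (memvD D1 (memvZ (- 1) D3)); rewrite combZ combD => h.
  by apply: (mem_comb_rescale n6 h); ring.
have y4 : comb 0 0 0 c4 0 0 0 0 \in I.
  move: (memvD D3 (memvD (memvZ 3 D2) (memvZ 2 D1))).
  rewrite !combZ !combD => h.
  by apply: (mem_comb_rescale n6 h); ring.
have y1 : comb c1 0 0 0 c5 0 0 c8 \in I.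
  move: (memvD D3 (memvD D2 (memvZ (- 2) D1))).
  rewrite !combZ !combD => h.
  by apply: (mem_comb_rescale n2 h); ring.
have y0 : comb 0 0 c3 0 0 c6 c7 0 \in I.
  move: (memvD (memvD (memvZ (- 1) D3) (memvZ (- 2) D2))
      (memvD D1 (memvZ 2 D0))).
  rewrite !combZ !combD => h.
  by apply: (mem_comb_rescale n2 h); ring.
(* act01 o act10 is 4 on e_1 and 1 on e_5, e_8; act10 o act01 is 4 on e_3 and 1
   on e_6, e_7. *)
have z1 : comb c1 0 0 0 0 0 0 0 \in I.
  move: (memvD (actI ord0 ord_max _ (actI ord_max ord0 _ y1)) (memvZ (- 1) y1)).
  rewrite act10_comb act01_comb combZ combD => h.
  by apply: (mem_comb_rescale n3 h); ring.
have z3 : comb 0 0 c3 0 0 0 0 0 \in I.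
  move: (memvD (actI ord_max ord0 _ (actI ord0 ord_max _ y0)) (memvZ (- 1) y0)).
  rewrite act01_comb act10_comb combZ combD => h.
  by apply: (mem_comb_rescale n3 h); ring.
split; [by split | split].
  by move: (memvD y1 (memvZ (- 1) z1)); rewrite combZ combD => h;
    apply: (mem_comb_rescale (oner_neq0 F) h); ring.
move: (actI ord0 ord_max _ (memvD y0 (memvZ (- 1) z3))).
by rewrite combZ combD act01_comb => h;
  apply: (mem_comb_rescale (oner_neq0 F) h); ring.
Qed.

(** * The irreducible summand S^3 V_2 *)

Lemma e1_mem_e1234 : e1 \in I -> {subset [:: e1; e2; e3; e4] <= I}.
Proof.
have n2 : 2 != 0 :> F := natr_neq0 1; have n3 : 3 != 0 :> F := natr_neq0 2.
have actI p q x : x \in I -> act p q x \in I by apply: idealI.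
rewrite !eE => E1.
(* From [e1] the action reaches 3 [e2] on one side, and 2 [e3], then 3 [e4] from [e3], on the
   other. *)
have E2 : comb 0 1 0 0 0 0 0 0 \in I.
  move: (actI ord0 ord_max _ E1); rewrite act01_comb => h.
  by apply: (mem_comb_rescale n3 h); ring.
have E3 : comb 0 0 1 0 0 0 0 0 \in I.
  move: (actI ord_max ord0 _ E1); rewrite act10_comb => h.
  by apply: (mem_comb_rescale n2 h); ring.
have E4 : comb 0 0 0 1 0 0 0 0 \in I.
  move: (actI ord_max ord0 _ E3); rewrite act10_comb => h.
  by apply: (mem_comb_rescale n3 h); ring.
by apply/allP; rewrite /= E1 E2 E3 E4.
Qed.

(** Each basis vector of S^3 V_2 can be moved back to a nonzero multiple of [e1]: [e2] and [e3] in
    one step, [e4] through [e3]. A nonzero component would thus put [e1] in [I]. *)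
Lemma e1_notin_comb c1 c2 c3 c4 c5 c6 c7 c8 :
  e1 \notin I -> comb c1 c2 c3 c4 c5 c6 c7 c8 \in I ->
  [/\ c1 = 0, c2 = 0, c3 = 0 & c4 = 0].
Proof.
have n2 : 2 != 0 :> F := natr_neq0 1.
have actI p q x : x \in I -> act p q x \in I by apply: idealI.
move=> e1I /mem_comb_components[[E1 E2 E3 E4] _].
have c1_0 c : comb c 0 0 0 0 0 0 0 \in I -> c = 0.
  move=> cI; apply/eqP; apply: contraNT e1I => nz_c; rewrite eE.
  by apply: (mem_comb_rescale nz_c cI); ring.
have c3_0 c : comb 0 0 c 0 0 0 0 0 \in I -> c = 0.
  move=> /(actI ord0 ord_max); rewrite act01_comb !mulr0 oppr0 => /c1_0/eqP.
  by rewrite mulf_eq0 (negPf n2) => /eqP.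
split; [exact: c1_0 | | exact: c3_0 |].
  by move: (actI ord_max ord0 _ E2); rewrite act10_comb !mulr0 oppr0 => /c1_0.
by move: (actI ord0 ord_max _ E4); rewrite act01_comb !mulr0 oppr0 => /c3_0.
Qed.

(** * The two copies of V_2 *)

Lemma mem_comb67 a b : comb 0 0 0 0 a 0 0 b \in I ->
  comb 0 0 0 0 0 (- a) b 0 \in I.
Proof.
(* This multiplication sends [e5] to [- e6] and [e8] to [e7], whence the sign in the second
   generator. *)
move/(idealI (alpha v ord0 ord_max ord0)).
by rewrite -/(act _ _ _) act10_comb !mulr0.
Qed.

Lemma comb58E a b : a *: e5 + b *: e8 = comb 0 0 0 0 a 0 0 b.
Proof. by rewrite !eE !combZ combD; apply: comb_congr; ring. Qed.

Lemma comb67E a b : - a *: e6 + b *: e7 = comb 0 0 0 0 0 (- a) b 0.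
Proof. by rewrite !eE !combZ combD; apply: comb_congr; ring. Qed.

(** The cases are the dimensions 2, 0 and 1 of the intersection of [I] with the plane spanned by
    [e5] and [e8]; the [e6], [e7] part follows by applying [act ord_max ord0]. *)
Lemma generators_e5678 :
  exists T, [/\ {subset T <= I},
    (forall a b, comb 0 0 0 0 a 0 0 b \in I ->
       comb 0 0 0 0 a 0 0 b \in span T /\ comb 0 0 0 0 0 (- a) b 0 \in span T) &
    [\/ T = [::], T = [:: e5; e6; e7; e8]
      | exists a b : F, (a, b) <> (0, 0) /\
          T = [:: a *: e5 + b *: e8; - a *: e6 + b *: e7]]].
Proof.
have [/andP[e5I e8I] | e58I] := boolP ((e5 \in I) && (e8 \in I)).
  exists [:: e5; e6; e7; e8]; split; [| | by constructor 2].
    have e6I : e6 \in I.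
      have n1 : - 1 != 0 :> F by rewrite oppr_eq0 oner_eq0.
      move: e5I; rewrite !eE => /mem_comb67 h.
      by apply: (mem_comb_rescale n1 h); ring.
    have e7I : e7 \in I by move: e8I; rewrite !eE => /mem_comb67; rewrite oppr0.
    by apply/allP; rewrite /= e5I e6I e7I e8I.
  move=> a b _; rewrite -comb58E -comb67E.
  by split; apply: memvD; apply: memvZ; apply: memv_span; rewrite !inE eqxx ?orbT.
pose U := (I :&: <<[:: e5; e8]>>)%VS.
have [U0 | nzU] := eqVneq U 0%VS.
  exists [::]; split=> [//| a b abI |]; last by constructor 1.
  have ab0 : comb 0 0 0 0 a 0 0 b = 0.
    apply/eqP; rewrite -memv0 -U0 memv_cap abI -comb58E.
    by apply: memvD; apply: memvZ; apply: memv_span; rewrite !inE eqxx ?orbT.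
  split; first by rewrite ab0 mem0v.
  have := congr1 (act ord_max ord0) ab0.
  rewrite act10_comb !mulr0 => ->; rewrite span_nil memv0; apply/eqP.
  (* Writing the zero map as [0 *: 0] lets [coefZ] kill its coefficients. *)
  apply: coef_inj => i j k; rewrite coef_act -(scale0r 0) !coefZ.
  by rewrite !mul0r !mulr0 !subr0.
have : vpick U != 0 by rewrite vpick0.
have : vpick U \in U by apply: memv_pick.
rewrite memv_cap => /andP[].
move: (vpick U) => u uI; rewrite span_cons span_seq1.
move=> /memv_addP[_ /vlineP[a ->] [_ /vlineP[b ->] def_u]] nz_u.
exists [:: a *: e5 + b *: e8; - a *: e6 + b *: e7]; split.
- move: uI; rewrite def_u comb58E comb67E => uI.
  by apply/allP; rewrite /= uI mem_comb67.
- move=> p q pqI.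
  have [t [-> ->]] : exists t, p = t * a /\ q = t * b.
    (* If the determinant were nonzero, Cramer's rule would give both [e5] and [e8] in [I]. *)
    have det0 : p * b = q * a.
      apply/eqP; rewrite -subr_eq0; apply: contraNT e58I => nz_det.
      move: uI; rewrite def_u comb58E => uI; apply/andP; split; rewrite eE.
        move: (memvD (memvZ b pqI) (memvZ (- q) uI)).
        rewrite !combZ combD => h.
        by apply: (mem_comb_rescale nz_det h); ring.
      move: (memvD (memvZ (- a) pqI) (memvZ p uI)).
      rewrite !combZ combD => h.
      by apply: (mem_comb_rescale nz_det h); ring.
    have [a0 | nz_a] := eqVneq a 0; last first.
      by exists (p / a); rewrite divfK // mulrAC det0 mulfK.
    have nz_b : b != 0.
      by apply: contra_neq nz_u => b0; rewrite def_u a0 b0 !scale0r addr0.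
    exists (q / b); rewrite divfK // a0 mulr0; split=> //.
    by apply: (mulIf nz_b); rewrite det0 a0 mulr0 mul0r.
  rewrite -comb58E -comb67E -!scalerA -mulrN -!scalerA -!scalerDr.
  by split; apply: memvZ; apply: memv_span; rewrite !inE eqxx ?orbT.
constructor 3; exists a, b; split=> // - [a0 b0].
by move: nz_u; rewrite def_u a0 b0 !scale0r addr0 eqxx.
Qed.

(** * Assembling the classification *)

Lemma generators_e1234 :
  exists S, [/\ {subset S <= I},
    (forall c1 c2 c3 c4 c5 c6 c7 c8, comb c1 c2 c3 c4 c5 c6 c7 c8 \in I ->
       c1 *: e1 + c2 *: e2 + c3 *: e3 + c4 *: e4 \in span S) &
    S = [::] \/ S = [:: e1; e2; e3; e4]].
Proof.
have [e1I | e1I] := boolP (e1 \in I).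
  exists [:: e1; e2; e3; e4]; split; [exact: e1_mem_e1234 | | by right].
  move=> *; do ?apply: memvD; apply: memvZ; apply: memv_span;
    by rewrite !inE eqxx ?orbT.
exists [::]; split=> [// | |]; last by left.
move=> c1 c2 c3 c4 c5 c6 c7 c8 /(e1_notin_comb e1I)[-> -> -> ->].
by rewrite !scale0r !addr0 mem0v.
Qed.

Lemma left_ideal_span : exists S T,
  [/\ I = span (S ++ T), S = [::] \/ S = [:: e1; e2; e3; e4] &
    [\/ T = [::], T = [:: e5; e6; e7; e8]
      | exists a b : F, (a, b) <> (0, 0) /\
          T = [:: a *: e5 + b *: e8; - a *: e6 + b *: e7]]].
Proof.
have [S [SI genS caseS]] := generators_e1234.
have [T [TI genT caseT]] := generators_e5678.
exists S, T; split=> //; apply/eqP; rewrite eqEsubv; apply/andP; split; last first.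
  by apply/span_subvP => x; rewrite mem_cat => /orP[/SI | /TI].
apply/subvP => x; have [c1 [c2 [c3 [c4 [c5 [c6 [c7 [c8 ->]]]]]]]] := combP x.
(* [genT] serves twice: its first half for (c5, c8), its second for (- c6, c7), where the two signs
   cancel. *)
move=> xI; have [_ [/genT[T58 _] /genT[_]]] := mem_comb_components xI.
rewrite opprK => T67; rewrite span_cat.
have -> : comb c1 c2 c3 c4 c5 c6 c7 c8 =
    (c1 *: e1 + c2 *: e2 + c3 *: e3 + c4 *: e4)
    + (comb 0 0 0 0 c5 0 0 c8 + comb 0 0 0 0 0 c6 c7 0).
  by rewrite !eE !combZ !combD; apply: comb_congr; ring.
exact: memv_add (genS _ _ _ _ _ _ _ _ xI) (memvD T58 T67).
Qed.

End LeftIdealsW2.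

Theorem lemma2 (F : fieldType) (charF0 : [pchar F] =i pred0)
    (V : vectType F) (v : 2.-tuple V) (v_basis : basis_of fullv v)
    (I : {vspace bilmap V}) (I_ideal : nontrivial_left_ideal (mulW v) I) :
  [\/ exists a b : F, (a, b) <> (0, 0) /\
        I = span [:: e1 v; e2 v; e3 v; e4 v;
                   a *: e5 v + b *: e8 v; - a *: e6 v + b *: e7 v],
      I = span [:: e1 v; e2 v; e3 v; e4 v],
      I = span [:: e5 v; e6 v; e7 v; e8 v]
    | exists a b : F, (a, b) <> (0, 0) /\
        I = span [:: a *: e5 v + b *: e8 v; - a *: e6 v + b *: e7 v]].
Proof.
have [idealI nzI ntI] := I_ideal.
have [S [T [def_I caseS caseT]]] := left_ideal_span charF0 v_basis idealI.
(* Of the six combinations, the two empty lists give the zero ideal and the two full ones the whole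
   algebra; the other four are the listed cases. *)
move: caseS caseT def_I => [->|->] [->|->|[a [b [nz_ab ->]]]] def_I.
- by case: nzI; rewrite def_I span_nil.
- by constructor 3.
- by constructor 4; exists a, b.
- by constructor 2.
- case: ntI; apply/eqP; rewrite eqEsubv subvf def_I; apply/subvP => x _.
  have [c1 [c2 [c3 [c4 [c5 [c6 [c7 [c8 ->]]]]]]]] := combP charF0 v_basis x.
  rewrite comb.unlock; do ?apply: memvD; apply: memvZ; apply: memv_span;
    by rewrite !inE eqxx ?orbT.
by constructor 1; exists a, b.
Qed.
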